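(* Let $n\ge 1$ and $\Sigma=\{0,1\}$. Let $\mu_n$ be the maximum, over all non-empty representable subsets $S\subseteq\Sigma^n$, of the length of a shortest word $w$ with $F_n(w)=S$, and let $\nu_n$ be the maximum, over all non-empty circularly representable subsets $S\subseteq\Sigma^n$, of the length of a shortest non-empty word $w$ with $C_n(w)=S$. Then $$\mu_n \le 2^{2n-2}+2^{n-1} \quad\text{and}\quad \nu_n\le 2^{2n-2}+2^{n-1}.$$
   Context: $\Sigma=\{0,1\}$. For a word $w$ over $\Sigma$, $F_n(w)$ denotes the set of length-$n$ (contiguous) factors of $w$ in the ordinary, non-circular sense. For a non-empty word $w$, $C_n(w)$ denotes the set of length-$n$ factors of $w$ interpreted circularly, i.e. the set of words $w[i]w[i+1]\cdots w[i+n-1]$ for $1\le i\le |w|$, with indices taken modulo $|w|$. A subset $S\subseteq\Sigma^n$ is representable (resp. circularly representable) if there is a non-empty word $w$ with $F_n(w)=S$ (resp. $C_n(w)=S$); such a $w$ is called a witness (resp. circular witness) for $S$. *)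

(* Defs.v *)
From mathcomp Require Import all_boot.
From mathcomp Require Import boolp.

Set Implicit Arguments.
Unset Strict Implicit.
Unset Printing Implicit Defensive.

Definition factors (n : nat) (w : seq bool) : {set n.-tuple bool} :=
  [set t : n.-tuple bool | infix t w].

(* The word may be shorter than n: positions wrap around as often as needed. *)
Definition cfactors (n : nat) (w : seq bool) : {set n.-tuple bool} :=
  [set [tuple nth false w ((i + j) %% size w) | j < n] | i : 'I_(size w)].

Definition witness (n : nat) (S : {set n.-tuple bool}) : pred (seq bool) :=
  fun w => (w != [::]) && (factors n w == S).

Definition cwitness (n : nat) (S : {set n.-tuple bool}) : pred (seq bool) :=
  fun w => (w != [::]) && (cfactors n w == S).

Definition representable (n : nat) (S : {set n.-tuple bool}) : Prop :=
  exists w, witness S w.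

Definition crepresentable (n : nat) (S : {set n.-tuple bool}) : Prop :=
  exists w, cwitness S w.

(* The value 0 is a dummy for predicates satisfied by no word. *)
Definition shortest_length (P : pred (seq bool)) : nat :=
  if pselect (exists k, [exists w : k.-tuple bool, P w]) is left exP
  then ex_minn exP else 0.

Lemma shortest_lengthP (P : pred (seq bool)) : (exists w, P w) ->
  (exists2 w, P w & size w = shortest_length P) /\
  (forall w, P w -> shortest_length P <= size w).
Proof.
move=> [w0 Pw0]; rewrite /shortest_length.
case: pselect => [exP|]; last first.
  by case; exists (size w0); apply/existsP; exists (in_tuple w0).
case: ex_minnP => k /existsP[w Pw] kmin; split.
  by exists w; rewrite ?size_tuple.
by move=> v Pv; apply: kmin; apply/existsP; exists (in_tuple v).
Qed.

Definition mu (n : nat) : nat :=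
  \max_(S : {set n.-tuple bool} | (S != set0) && `[< representable S >])
    shortest_length (witness S).

Definition nu (n : nat) : nat :=
  \max_(S : {set n.-tuple bool} | (S != set0) && `[< crepresentable S >])
    shortest_length (cwitness S).

(* Main.v *)
(* A set [S] of words of length [n] is a set of edges of the de Bruijn graph,
   which has m = 2 ^ (n - 1) vertices, and a (circular) witness of [S] is a
   (closed) walk with edge set [S].  Start from a short walk and, as long as an
   edge is missing, insert a shortest detour through a missing edge that leaves
   an already visited vertex.  All out-degrees are at most 2, so each detour but
   one, at the end vertex, uses up a distinct vertex: there are at most m + 1
   detours, and at most m if [S] is not full.  A detour has at most m edges,
   whence m (m + 1) in the circular case.  If a witness walk from s to t cannot
   be closed, no simple cycle passes through both s and t, so detours have
   at most m - 1 edges; if [S] is full, they can be taken of length n. *)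

Require Import Defs.
From mathcomp Require Import all_boot.
From mathcomp Require Import boolp zify.

Set Implicit Arguments.
Unset Strict Implicit.
Unset Printing Implicit Defensive.

(** * Walks in a finite directed multigraph *)

Section Multigraph.

Variables (V E : finType) (src tgt : E -> V).
Implicit Types (u v s t : V) (e f : E) (p q r : seq E) (S : {set E}).

Fixpoint walk u p v : bool :=
  if p is e :: p' then (src e == u) && walk (tgt e) p' v else u == v.

Lemma walk_cat p q u v w : walk u p v -> walk v q w -> walk u (p ++ q) w.
Proof.
elim: p u => [|e p IHp] u /=; first by move/eqP->.
by case/andP=> -> /IHp H /H.
Qed.

Lemma walk_catE p q u w :
  walk u (p ++ q) w -> exists2 v, walk u p v & walk v q w.
Proof.
elim: p u => [|e p IHp] u /=; first by exists u.
by case/andP=> -> /IHp.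
Qed.

Lemma walk_cat_cons p e q u w :
  walk u (p ++ e :: q) w -> walk u p (src e) /\ walk (tgt e) q w.
Proof. by case/walk_catE=> v Hp /= /andP[/eqP Ev Hq]; rewrite Ev. Qed.

Lemma walk_through u p w v : walk u p w -> v \in map src p ->
  exists p1 p2, [/\ p = p1 ++ p2, walk u p1 v & walk v p2 w].
Proof.
move=> Wp /mapP[e ep ->]; case/splitPr: p / ep Wp => p1 p2 Wp.
have [W1 W2] := walk_cat_cons Wp.
by exists p1, (e :: p2); rewrite /= eqxx.
Qed.

Lemma walk_edge e : walk (src e) [:: e] (tgt e).
Proof. by rewrite /= !eqxx. Qed.

(** Built from the end backwards: if the new start recurs on the loop-free tail, the walk resumes at
    that recurrence. Including [v] makes all visited vertices distinct, the end as well. *)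
Lemma walk_simple u p v : walk u p v ->
  exists q, [/\ {subset q <= p}, walk u q v & uniq (v :: map src q)].
Proof.
elim: p u => [|e p IHp] u /=; first by exists [::].
case/andP=> /eqP Eu /IHp[q [sqp Wq Uq]].
have [<-|neq_vu] := eqVneq v u; first by exists [::]; rewrite /= eqxx.
have [/mapP[f fq Ef]|uNq] := boolP (u \in map src q).
  case/splitPr: q / fq sqp Wq Uq => q1 q2 sqp Wq Uq.
  exists (f :: q2); split.
  - by move=> g gq; rewrite inE sqp ?orbT // mem_cat gq orbT.
  - by case: (walk_cat_cons Wq) => _; rewrite /= Ef eqxx.
  - rewrite -cons_uniq; apply: subseq_uniq Uq; rewrite map_cat /= eqxx.
    exact: suffix_subseq.
exists (e :: q); split.
- by move=> g; rewrite !inE => /orP[->//|/sqp->]; rewrite orbT.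
- by rewrite /= Eu eqxx.
- by move: Uq; rewrite /= inE negb_or Eu neq_vu uNq.
Qed.

Lemma walk_bound u p v : walk u p v ->
  exists q, [/\ {subset q <= p}, walk u q v & size q < #|V|].
Proof.
case/walk_simple=> q [sqp Wq /card_uniqP Uq]; exists q; split=> //.
by rewrite -(size_map src) -[_.+1]/(size (v :: _)) -Uq max_card.
Qed.

(** As long as the edges of [q] belong to [p], it stays on vertices of [p]; so its first edge
    outside [p] leaves a vertex of [p], possibly the end [t]. *)
Lemma uncovered_source s p t q z : walk s p t -> walk s q z ->
  ~~ all (mem p) q ->
  exists e p1 p2, [/\ e \in q, e \notin p, p = p1 ++ p2,
    walk s p1 (src e) & walk (src e) p2 t].
Proof.
move=> Wp; pose visited y p1 p2 := [/\ p = p1 ++ p2, walk s p1 y & walk y p2 t].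
suff gen y p1 p2 : visited y p1 p2 -> walk y q z -> ~~ all (mem p) q ->
    exists e p1 p2, [/\ e \in q, e \notin p & visited (src e) p1 p2].
  move=> Wq qNp; have [|e [r1 [r2 [eq eNp [Er W1 W2]]]]] := gen s [::] p _ Wq qNp.
    by split=> //=.
  by exists e, r1, r2.
elim: q y p1 p2 => [|f q IHq] y p1 p2 //= Vy /andP[/eqP Ey Wq].
have [fp /= qNp|fNp _] := boolP (f \in p); last first.
  by exists f, p1, p2; rewrite mem_head Ey.
have [r1 [r2 Vr]]: exists r1 r2, visited (tgt f) r1 r2.
  have [r1 [r2 Ep]]: exists r1 r2, p = r1 ++ f :: r2.
    by case/splitPr: fp => r1 r2; exists r1, r2.
  move: Wp; rewrite {1}Ep => /walk_cat_cons[H1 H2].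
  exists (rcons r1 f), r2; split; rewrite ?cat_rcons //.
  by rewrite -cats1; apply: walk_cat H1 (walk_edge f).
have [e [r3 [r4 [eq eNp Ve]]]] := IHq _ _ _ Vr Wq qNp.
by exists e, r3, r4; rewrite inE eq orbT.
Qed.

(** * Out-degrees and the number of detours *)

Definition outdeg S u := #|[set e in S | src e == u]|.

(* A walk ending at [t] uses an out-edge of each vertex that it visits, except
   possibly [t]; [excess] counts its edges beyond these unavoidable ones. *)
Definition excess t S := \sum_u (outdeg S u - (u != t)).

Lemma outdegS S1 S2 u : S1 \subset S2 -> outdeg S1 u <= outdeg S2 u.
Proof.
move=> sS; apply/subset_leq_card/subsetP=> e; rewrite !inE => /andP[eS ->].
by rewrite (subsetP sS).
Qed.

(** Only the term at [src e] needs care. If [src e] is not [t], then [p2] is non-empty and already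
    leaves [src e], so the truncated subtraction of 1 does not swallow the new edge [e]. *)
Lemma excess_detour p1 e r p2 t : e \notin p1 ++ p2 -> walk (src e) p2 t ->
  excess t [set f in p1 ++ p2] < excess t [set f in p1 ++ (e :: r) ++ p2].
Proof.
move=> eN W2; set S1 := finset _; set S2 := finset _.
have sS: S1 \subset S2.
  apply/subsetP=> f; rewrite !inE !mem_cat.
  by case/orP=> ->; rewrite ?orbT.
rewrite /excess (bigD1 (src e)) //= [leqRHS](bigD1 (src e)) //= -addSn.
apply: leq_add; last by apply: leq_sum => u _; rewrite leq_sub2r ?outdegS.
have ltd: outdeg S1 (src e) < outdeg S2 (src e).
  apply/proper_card/properP; split.
    apply/subsetP=> f; move: (subsetP sS f).
    by rewrite !inE => S12 /andP[/S12-> ->].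
  by exists e; rewrite !inE ?eqxx ?andbT // !mem_cat mem_head !orbT.
rewrite ltn_sub2rE //; case: eqVneq => //= neq_t.
have [f fp2 fe]: exists2 f, f \in p2 & src f == src e.
  case: p2 W2 {S1 S2 eN sS ltd} => [/eqP e_t|f p2 /andP[f_e _]].
    by rewrite e_t eqxx in neq_t.
  by exists f; rewrite ?mem_head.
by apply/card_gt0P; exists f; rewrite !inE mem_cat fp2 orbT.
Qed.

(* Each detour [e :: r] through a missing edge costs at most [L] steps and
   raises the excess. *)
Lemma walk_cover S s t q z L p0 :
    walk s q z -> (forall e, (e \in q) = (e \in S)) ->
    walk s p0 t -> {subset p0 <= S} ->
    (forall p e, walk s p t -> {subset p <= S} -> e \in S -> e \notin p ->
       exists r, [/\ walk (tgt e) r (src e), {subset r <= S} & size r < L]) ->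
  exists p, [/\ walk s p t, [set e in p] = S &
    size p + L * excess t [set e in p0] <= size p0 + L * excess t S].
Proof.
move=> Wq qS Wp0 sp0 back.
(* Induction on the number of edges of [S] still missing from the walk. *)
have [k] := ubnP (#|S| - #|[set e in p0]|).
elim: k p0 Wp0 sp0 => // k IHk p0 Wp0 sp0 /ltnSE lek.
have [/allP sq|Nsq] := boolP (all (mem p0) q).
  exists p0; suff ->: [set e in p0] = S by [].
  by apply/setP=> e; rewrite inE -qS; apply/idP/idP=> [/sp0|/sq]; rewrite ?qS.
have [e [p1 [p2 [eq eN Ep W1 W2]]]] := uncovered_source Wp0 Wq Nsq.
have eS: e \in S by rewrite -qS.
have [r [Wr sr ltrL]] := back _ _ Wp0 sp0 eS eN.
have sub: {subset p1 ++ (e :: r) ++ p2 <= S}.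
  move=> f; rewrite !mem_cat inE -!orbA => /or4P[fp|/eqP->//|/sr//|fp].
    by apply: sp0; rewrite Ep mem_cat fp.
  by apply: sp0; rewrite Ep mem_cat fp orbT.
have [||p [Wp Sp le_p]] := IHk (p1 ++ (e :: r) ++ p2) _ sub.
- apply: walk_cat W1 _; apply: walk_cat W2.
  by rewrite /= eqxx.
- apply: leq_trans lek; apply: ltn_sub2l.
    apply/proper_card/properP; split; first by apply/subsetP=> f; rewrite inE => /sp0.
    by exists e; rewrite ?inE.
  apply/proper_card/properP; split.
    apply/subsetP=> f; rewrite !inE Ep !mem_cat.
    by case/orP=> ->; rewrite ?orbT.
  by exists e; rewrite !inE // !mem_cat mem_head orbT.
exists p; split=> //.
have := excess_detour r (etrans (congr1 (fun x => e \notin x) (esym Ep)) eN) W2.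
rewrite -Ep => /(leq_mul (leqnn L)); rewrite mulnS.
move: le_p ltrL; rewrite Ep !size_cat /=.
do 3!move: (L * excess t _) => ?; clear; lia.
Qed.

(** * Short walks with a prescribed edge set *)

Lemma closed_walk_cover S s q : walk s q s -> (forall e, (e \in q) = (e \in S)) ->
  exists p, [/\ walk s p s, [set e in p] = S & size p <= #|V| * excess s S].
Proof.
move=> Wq qS.
have [|//|p e _ _ eS _|p [Wp Sp le_p]] := @walk_cover S s s q s #|V| [::] Wq qS.
- by rewrite /= eqxx.
(* The way back follows [q] from [e] to its end [s], then from [s] again up to [e]; removing loops
   makes it shorter than [#|V|]. *)
- move: eS; rewrite -qS => eq; case/splitPr: q / eq Wq qS => a b Wq qS.
  have [Wa Wb] := walk_cat_cons Wq.
  have [r [sr Wr ltr]] := walk_bound (walk_cat Wb Wa).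
  exists r; split=> // f /sr; rewrite -qS !mem_cat inE.
  by case/orP=> ->; rewrite ?orbT.
by exists p; split=> //; apply: leq_trans le_p; apply: leq_addr.
Qed.

(** The starting walk must already lead from [s] to [t], which costs the extra [#|V|.-1]. A
    loop-free detour closes up to a simple cycle, and such a cycle misses [s] or [t]. *)
Lemma open_walk_cover S s t q : walk s q t -> (forall e, (e \in q) = (e \in S)) ->
    (forall r, {subset r <= S} -> ~~ walk t r s) ->
  exists p, [/\ walk s p t, [set e in p] = S &
                size p <= #|V|.-1 + #|V|.-1 * excess t S].
Proof.
move=> Wq qS noback.
have [p0 [sp0 Wp0 ltp0]] := walk_bound Wq.
have {}sp0: {subset p0 <= S} by move=> e /sp0; rewrite qS.
have [//|p e Wp sp eS eN|p [Wp Sp le_p]] :=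
  @walk_cover S s t q t #|V|.-1 p0 Wq qS Wp0; last first.
  exists p; split=> //; apply: (leq_trans (leq_addr _ _)).
  apply: (leq_trans le_p); rewrite leq_add2r; lia.
have [a [b Eq]]: exists a b, q = a ++ e :: b.
  by move: eS; rewrite -qS => /splitPr[a b]; exists a, b.
have [Wa Wb] : walk s a (src e) /\ walk (tgt e) b t by apply: walk_cat_cons; rewrite -Eq.
have sa: {subset a <= S} by move=> f fa; rewrite -qS Eq mem_cat fa.
have sb: {subset b <= S} by move=> f fb; rewrite -qS Eq mem_cat inE fb !orbT.
have cat_sub r1 r2 : {subset r1 <= S} -> {subset r2 <= S} -> {subset r1 ++ r2 <= S}.
  by move=> s1 s2 f; rewrite mem_cat => /orP[/s1|/s2].
pose reach u v := exists2 r, {subset r <= S} & walk u r v.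
have [r sr Wr]: reach (tgt e) (src e).
  (* [p] joins [s] to [t] without [e], so it enters the part of the graph
     reachable from [tgt e] by another edge, and this edge precedes [e] in [q]. *)
  have enter y p' : walk y p' t -> {subset p' <= S} -> e \notin p' ->
      reach (tgt e) y \/ reach (tgt e) (src e).
    elim: p' y => [|f p' IHp] y /=; first by move/eqP-> => _ _; left; exists b.
    case/andP=> /eqP <- Wp' sp'; rewrite inE negb_or => /andP[neq_ef eNp'].
    have fS: f \in S by rewrite sp' ?mem_head.
    have [|[r sr Wr]|] := IHp _ Wp' _ eNp'; [ | |by right].
      by move=> g gp; apply: sp'; rewrite inE gp orbT.
    move: fS; rewrite -qS Eq mem_cat inE eq_sym (negPf neq_ef) /=.
    case/orP=> [fa|fb].
      case/splitPr: a / fa Wa sa {Eq} => a1 a2 /walk_cat_cons[_ Wa2] sa.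
      right; exists (r ++ a2); last exact: walk_cat Wr Wa2.
      by apply: cat_sub => // g ga; apply: sa; rewrite mem_cat inE ga !orbT.
    case/splitPr: b / fb Wb sb {Eq} => b1 b2 /walk_cat_cons[Wb1 _] sb.
    by left; exists b1 => // g gb; apply: sb; rewrite mem_cat gb.
  have [[r sr Wr]|//] := enter _ _ Wp sp eN.
  by exists (r ++ a); [apply: cat_sub | apply: walk_cat Wr Wa].
have [r' [sr' Wr' Ur']] := walk_simple Wr; exists r'.
have {sr'} sr': {subset r' <= S} by move=> f /sr'/sr.
split=> //; set c := e :: r'.
have Wc: walk (src e) c (src e) by rewrite /= eqxx.
have sc: {subset c <= S} by move=> f; rewrite inE => /predU1P[->|/sr'].
(* A cycle through [s] and [t] would contain a walk from [t] to [s], against [noback]. The missed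
   vertex [x] bounds the length of [c] by [#|V|.-1]. *)
have [x xN]: exists x, x \notin map src c.
  have [tc|] := boolP (t \in map src c); last by exists t.
  have [sc'|] := boolP (s \in map src c); last by exists s.
  have [c1 [c1' [Ec1 W1 _]]] := walk_through Wc sc'.
  have [c2' [c2 [Ec2 _ W2]]] := walk_through Wc tc.
  have/negP[] : ~~ walk t (c2 ++ c1) s; last exact: walk_cat W2 W1.
  apply/noback/cat_sub => f fc; apply: sc.
    by rewrite Ec2 mem_cat fc orbT.
  by rewrite Ec1 mem_cat fc.
have /card_uniqP Uxc: uniq (x :: map src c) by rewrite cons_uniq xN.
have: #|x :: map src c| <= #|V| by apply: max_card.
by rewrite Uxc /= size_map; case: #|V|.
Qed.

End Multigraph.

(** * Windows of infinite sequences, a common form for finite and circular words *)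

Definition window (l : nat) (x : nat -> bool) (i : nat) : l.-tuple bool :=
  [tuple x (i + j) | j < l].

Lemma nth_window l x i j : j < l -> nth false (window l x i) j = x (i + j).
Proof. by move=> ltjl; rewrite (nth_mktuple _ _ (Ordinal ltjl)). Qed.

Lemma eq_window l x y i k : (forall j, j < l -> x (i + j) = y (k + j)) ->
  window l x i = window l y k.
Proof. by move=> eqxy; apply: eq_from_tnth => j; rewrite !tnth_mktuple eqxy. Qed.

Lemma window_tuple l (t : l.-tuple bool) : window l (nth false t) 0 = t.
Proof. by apply: eq_from_tnth => j; rewrite tnth_mktuple -tnth_nth. Qed.

Lemma window_catl l (t : l.-tuple bool) s : window l (nth false (t ++ s)) 0 = t.
Proof.
rewrite -[RHS]window_tuple; apply: eq_window => j ltj.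
by rewrite nth_cat size_tuple ltj.
Qed.

(** * Words as walks in the de Bruijn graph *)

Section DeBruijn.

Variable n : nat.
Implicit Types (u v : n.-tuple bool) (e f : n.+1.-tuple bool).
Implicit Types (p : seq (n.+1.-tuple bool)) (S : {set n.+1.-tuple bool}).
Implicit Types (w : seq bool) (x : nat -> bool).

(** Vertices have length [n] and edges length [n.+1]: this [n] is one less than the length of the
    factors in the theorem. *)
Definition dsrc e : n.-tuple bool := window n (nth false e) 0.
Definition dtgt e : n.-tuple bool := window n (nth false e) 1.
Definition dwalk := walk dsrc dtgt.

Lemma dsrc_window x i : dsrc (window n.+1 x i) = window n x i.
Proof. by apply: eq_window => j ltj; rewrite nth_window // ltnW. Qed.

Lemma dtgt_window x i : dtgt (window n.+1 x i) = window n x i.+1.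
Proof. by apply: eq_window => j ltj; rewrite nth_window ?addSnnS. Qed.

Definition windows x l := [seq window n.+1 x i | i <- iota 0 l].

Lemma dwalk_windows x l : dwalk (window n x 0) (windows x l) (window n x l).
Proof.
suff gen i : dwalk (window n x i) [seq window n.+1 x k | k <- iota i l]
  (window n x (i + l)) by apply: (gen 0).
elim: l i => [|l IHl] i; first by rewrite addn0 /dwalk /=.
by rewrite /dwalk /= dsrc_window eqxx dtgt_window -addSnnS; apply: IHl.
Qed.

Definition letters p : seq bool := map (@thead n bool) p.

(** Each step of a walk drops the first letter of its edge, so these letters followed by the end
    vertex recover the word. *)
Definition spell p v : seq bool := letters p ++ v.

Lemma dwalk_spell u p v : dwalk u p v ->
  p = windows (nth false (spell p v)) (size p).
Proof.
move=> Wp.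
(* The induction needs the start vertex as well, to identify the letters of the first edge after its
   head. *)
suff [] : u = window n (nth false (spell p v)) 0 /\
   p = windows (nth false (spell p v)) (size p) by [].
elim: p u Wp => [|e p IHp] u /=; first by move/eqP->; rewrite window_tuple.
rewrite /windows /= => /andP[/eqP <-] /IHp[Etgt Ep].
have Ee j : j < n.+1 -> nth false (spell (e :: p) v) j = nth false e j.
  case: j => [|j] ltj; first by rewrite /= /thead (tnth_nth false).
  have := congr1 (fun t : n.-tuple bool => nth false t j) Etgt.
  by rewrite !nth_window.
split; first by apply: eq_window => j ltj; rewrite Ee // ltnW.
congr cons.
  by rewrite -[LHS]window_tuple; apply: eq_window => j ltj; rewrite Ee.
rewrite {1}Ep (iotaDl 1 0) -map_comp; apply: eq_map => i /=.
by apply: eq_window.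
Qed.

(** Truncated subtraction leaves no windows exactly when [w] is too short to have a factor of length
    [n.+1]. *)
Lemma factors_windows w e :
  (e \in windows (nth false w) (size w - n)) = (e \in factors n.+1 w).
Proof.
rewrite inE; apply/mapP/infixP => [[i]|[a [b ->]]].
  rewrite mem_iota add0n ltn_subRL => /andP[_ lti] ->.
  exists (take i w), (drop (i + n.+1) w).
  rewrite -{1}(cat_take_drop i w) -[in drop (i + _) w]addnC -drop_drop.
  rewrite -{1}(cat_take_drop n.+1 (drop i w)); congr (_ ++ (_ ++ _)).
  apply: (@eq_from_nth _ false) => [|j].
    rewrite size_tuple size_takel // size_drop; lia.
  rewrite size_takel ?size_drop => [ltj|]; last by lia.
  by rewrite nth_take // nth_drop nth_window.
exists (size a).
  by rewrite mem_iota !size_cat size_tuple ltn_subRL addnC ltn_add2l leq_addr.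
rewrite -[LHS]window_tuple; apply: eq_window => j ltj.
by rewrite add0n nth_cat ltnNge leq_addr /= addKn nth_cat size_tuple ltj.
Qed.

Lemma factors_spell u p v : dwalk u p v -> factors n.+1 (spell p v) = [set e in p].
Proof.
move=> Wp; apply/setP=> e; rewrite -factors_windows inE.
by rewrite size_cat size_map size_tuple addnK -(dwalk_spell Wp).
Qed.

Lemma size_spell p v : size (spell p v) = size p + n.
Proof. by rewrite size_cat size_map size_tuple. Qed.

(** * Circular words as closed walks *)

Definition circ w : nat -> bool := fun i => nth false w (i %% size w).

Lemma cfactors_windows w e :
  (e \in windows (circ w) (size w)) = (e \in cfactors n.+1 w).
Proof.
apply/mapP/imsetP => [[i]|[i _ ->]].
  by rewrite mem_iota => /andP[_ lti] ->; exists (Ordinal lti).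
by exists (val i); rewrite ?mem_iota /=.
Qed.

Lemma window_circ w l : window l (circ w) (size w) = window l (circ w) 0.
Proof. by apply: eq_window => j _; rewrite /circ modnDl. Qed.

Lemma cfactors_dwalk w :
  dwalk (window n (circ w) 0) (windows (circ w) (size w)) (window n (circ w) 0).
Proof. by rewrite -{2}window_circ dwalk_windows. Qed.

Lemma dwalk_nth u p v e i : dwalk u p v -> i.+1 < size p ->
  dtgt (nth e p i) = dsrc (nth e p i.+1).
Proof.
elim: p u i => [|f p IHp] u i //= /andP[_ Wp].
case: i => [|i]; last exact: IHp Wp.
by case: p Wp {IHp} => //= g p /andP[/eqP].
Qed.

Lemma dwalk_last u p v e : dwalk u p v -> 0 < size p ->
  dtgt (nth e p (size p).-1) = v.
Proof.
rewrite nth_last; case: p => //= f p /andP[_ Wp] _.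
by elim: p f Wp => [|g p IHp] f /= => [/eqP|/andP[_ /IHp]].
Qed.

Lemma cfactors_closed u p : dwalk u p u ->
  cfactors n.+1 (letters p) = [set e in p].
Proof.
case: p => [|e0 p0].
  (* The empty word has no positions, hence no circular factors. *)
  move=> _; apply/setP=> e; rewrite !inE; apply/imsetP; case; case=> //.
set p := e0 :: p0 => Wp; set l := size p.
have next i : dtgt (nth e0 p (i %% l)) = dsrc (nth e0 p (i.+1 %% l)).
  have ltil : i %% l < l by rewrite ltn_mod.
  have [eq_l|neq_l] := eqVneq (i %% l).+1 l.
    have -> : i.+1 %% l = 0 by rewrite -addn1 -modnDml addn1 eq_l modnn.
    rewrite -[i %% l]/((i %% l).+1.-1) eq_l (dwalk_last e0 Wp) //.
    by case/andP: Wp => /eqP.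
  have ltSil : (i %% l).+1 < l by rewrite ltn_neqAle neq_l.
  have -> : i.+1 %% l = (i %% l).+1 by rewrite -addn1 -modnDml addn1 modn_small.
  exact: dwalk_nth Wp ltSil.
(* Following [j] edges brings letter [j] to the front, even when the walk is shorter than [n.+1] and
   is traversed several times. *)
have letter j : j < n.+1 -> forall i,
    nth false (nth e0 p (i %% l)) j = circ (letters p) (i + j).
  elim: j => [|j IHj] ltj i.
    rewrite /circ size_map addn0 (nth_map e0) ?ltn_mod //.
    by rewrite /thead (tnth_nth false).
  rewrite -addSnnS -IHj 1?ltnW //.
  have := congr1 (fun t : n.-tuple bool => nth false t j) (next i).
  by rewrite !nth_window.
have Ep: p = windows (circ (letters p)) l.
  apply: (@eq_from_nth _ e0) => [|i lti]; first by rewrite size_map size_iota.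
  rewrite (nth_map 0) ?size_iota // nth_iota // add0n.
  rewrite -[LHS]window_tuple; apply: eq_window => j ltj.
  by rewrite add0n -letter // modn_small.
by apply/setP=> e; rewrite in_set -cfactors_windows size_map -Ep.
Qed.

(** * Out-degrees and excess in the de Bruijn graph *)

Lemma outdeg_le2 S u : outdeg dsrc S u <= 2.
Proof.
(* An edge is determined by its source and its last letter. *)
rewrite -card_bool /outdeg; apply: (leq_card_in (fun e => tnth e ord_max)) => e f.
rewrite !inE => /andP[_ /eqP eu] /andP[_ /eqP fu] Elast.
apply: eq_from_tnth => i; have [lti|leni] := ltnP i n.
  have := congr1 (fun t : n.-tuple bool => nth false t i) (etrans eu (esym fu)).
  by rewrite !nth_window //= !(tnth_nth false).
have -> // : i = ord_max.
by apply/val_inj/eqP; rewrite eqn_leq leni -ltnS ltn_ord.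
Qed.

(** Only the end vertex forgoes the subtraction of 1. *)
Lemma excess_le t S : excess dsrc t S <= \sum_u (outdeg dsrc S u).-1 + 1.
Proof.
have -> : 1 = \sum_u (u == t) by rewrite -big_mkcond big_pred1_eq.
rewrite -big_split leq_sum // => u _ /=; case: (u == t) => /=; lia.
Qed.

Lemma excess_le_expn t S : excess dsrc t S <= (2 ^ n).+1.
Proof.
apply: leq_trans (excess_le t S) _; rewrite addn1 ltnS.
rewrite -card_bool -card_tuple -sum1_card leq_sum // => u _.
by have := outdeg_le2 S u; lia.
Qed.

(** The source of a missing edge has out-degree at most 1 in [S], so its term in the bound of
    [excess_le] vanishes. *)
Lemma excess_le_expn_proper t S : S != setT -> excess dsrc t S <= 2 ^ n.
Proof.
move=> neqST; apply: leq_trans (excess_le t S) _; rewrite addn1.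
have [e eNS] : exists e, e \notin S.
  apply/existsP; rewrite -negb_forall; apply: contra neqST => /forallP allS.
  by apply/eqP/setP=> e; rewrite inE allS.
rewrite -card_bool -card_tuple -sum1_card.
rewrite (bigD1 (dsrc e)) // [leqRHS](bigD1 (dsrc e)) //=.
have /eqP-> : (outdeg dsrc S (dsrc e)).-1 == 0.
  have : outdeg dsrc S (dsrc e) < outdeg dsrc setT (dsrc e).
    apply/proper_card/properP; split.
      by apply/subsetP=> f; rewrite !inE => /andP[].
    by exists e; rewrite !inE ?eqxx ?(negPf eNS).
  by move=> /leq_trans/(_ (outdeg_le2 setT _)); case: outdeg => [|[]].
rewrite add0n add1n ltnS leq_sum // => u _.
by have := outdeg_le2 S u; lia.
Qed.

(** * Short witnesses *)

Lemma short_cwitness S : S != set0 -> crepresentable S ->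
  exists2 w, cwitness S w & size w <= 2 ^ n * (2 ^ n).+1.
Proof.
move=> S0 [w /andP[_ /eqP Sw]].
have qS e : (e \in windows (circ w) (size w)) = (e \in S).
  by rewrite cfactors_windows Sw.
have [p [Wp Sp le_p]] := closed_walk_cover (cfactors_dwalk w) qS.
exists (letters p).
  rewrite /cwitness (cfactors_closed Wp) Sp eqxx andbT.
  apply: contraNneq S0 => /eqP; rewrite -size_eq0 size_map => /nilP p0.
  by rewrite -Sp p0; apply/eqP/setP=> e; rewrite !inE.
rewrite size_map; apply: leq_trans le_p _.
by rewrite card_tuple card_bool leq_mul2l excess_le_expn orbT.
Qed.

(** The windows of the concatenation [u ++ v] lead from [u] to [v]. *)
Lemma dwalk_between u v : exists2 r, dwalk u r v & size r = n.
Proof.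
exists (windows (nth false (u ++ v)) n); last by rewrite size_map size_iota.
have := dwalk_windows (nth false (u ++ v)) n; rewrite window_catl.
suff -> : window n (nth false (u ++ v)) n = v by [].
rewrite -[RHS]window_tuple; apply: eq_window => j ltj.
by rewrite nth_cat size_tuple ltnNge leq_addr /= addKn.
Qed.

(** Every edge can be reached from every vertex, so edges can be strung together. Applied to all
    edges, this gives the reference walk for the full set. *)
Lemma dwalk_through_all u (es : seq (n.+1.-tuple bool)) :
  exists q v, dwalk u q v /\ {subset es <= q}.
Proof.
elim: es u => [|e es IHes] u; first by exists [::], u; rewrite /dwalk /= eqxx.
have [r Wr _] := dwalk_between u (dsrc e).
have [q [v [Wq sq]]] := IHes (dtgt e).
exists (r ++ e :: q), v; split.
  by apply: walk_cat Wr _; rewrite /= eqxx.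
move=> f; rewrite !inE mem_cat inE => /predU1P[->|/sq->].
  by rewrite eqxx orbT.
by rewrite !orbT.
Qed.

(* The walk starts with a loop, which saves one detour. *)
Lemma full_cover : exists u p v,
  [/\ dwalk u p v, [set e in p] = setT & size p + n <= n.+1 * (2 ^ n).+1].
Proof.
pose u := window n xpred0 0; pose e := window n.+1 xpred0 0.
have eu : dsrc e = u by rewrite dsrc_window.
have eu' : dtgt e = u by rewrite dtgt_window; apply: eq_window.
have [q [v [Wq sq]]] := dwalk_through_all u (enum setT).
have qT f : (f \in q) = (f \in [set: n.+1.-tuple bool]).
  by rewrite inE sq // mem_enum inE.
have We : dwalk u [:: e] u by rewrite /dwalk /= eu eu' eqxx.
have [||p [Wp Sp le_p]] := walk_cover (L := n.+1) Wq qT We.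
- by move=> f _; rewrite inE.
- move=> _ f _ _ _ _; have [r Wr size_r] := dwalk_between (dtgt f) (dsrc f).
  by exists r; split=> //; [move=> g _; rewrite inE | rewrite size_r].
exists u, p, u; split=> //.
(* At the end vertex [u] nothing is subtracted, so the loop counts fully. This saves one multiple of
   [n.+1], which pays for the loop itself and the final [n] letters. *)
have ex1 : 0 < excess dsrc u [set f in [:: e]].
  rewrite /excess (bigD1 u) //= eqxx subn0 addn_gt0; apply/orP; left.
  by apply/card_gt0P; exists e; rewrite !inE eu !eqxx.
have := excess_le_expn u setT; move: le_p ex1 => /=.
move: (excess _ _ _) (excess _ _ _) => b a le1 le2 le3.
have : n.+1 * 1 <= n.+1 * a by rewrite leq_mul2l le2 orbT.
have : n.+1 * b <= n.+1 * (2 ^ n).+1 by rewrite leq_mul2l le3 orbT.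
move: (_ * b) (_ * a) (_ * _.+1) le1; clear; lia.
Qed.

Lemma short_witness S : S != set0 -> representable S ->
  exists2 w, witness S w & size w <= 2 ^ n * (2 ^ n).+1.
Proof.
move=> S0 [w /andP[_ /eqP Sw]].
suff [u [p [v [Wp Sp le_p]]]] : exists u p v, [/\ dwalk u p v, [set e in p] = S &
    size p + n <= 2 ^ n * (2 ^ n).+1].
  exists (spell p v); last by rewrite size_spell.
  rewrite /witness (factors_spell Wp) Sp eqxx andbT.
  apply: contraNneq S0 => /eqP.
  rewrite -size_eq0 size_spell addn_eq0 => /andP[/nilP p0 _].
  by rewrite -Sp p0; apply/eqP/setP=> e; rewrite !inE.
have [->|neqST] := eqVneq S setT.
  have [u [p [v [Wp Sp le_p]]]] := full_cover; exists u, p, v; split=> //.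
  by apply: leq_trans le_p _; rewrite leq_mul2r ltn_expl.
have qS e : (e \in windows (nth false w) (size w - n)) = (e \in S).
  by rewrite factors_windows Sw.
set q := windows _ _ in qS; set s := window n (nth false w) 0.
set t := window n (nth false w) (size w - n).
have Wq : dwalk s q t by apply: dwalk_windows.
have cardV : #|{:n.-tuple bool}| = 2 ^ n by rewrite card_tuple card_bool.
have ltn2 : n < 2 ^ n by rewrite ltn_expl.
have [[r sr Wr]|noback] := pselect (exists2 r, {subset r <= S} & dwalk t r s).
  have cS e : (e \in q ++ r) = (e \in S).
    by rewrite mem_cat qS; apply/orP/idP=> [[//|/sr]|eS]; last left.
  have [p [Wp Sp]] := closed_walk_cover (walk_cat Wq Wr) cS.
  rewrite cardV => le_p; exists s, p, s; split=> //; rewrite mulnS addnC.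
  (* Since [S] is proper, a detour of length at most [2 ^ n] is saved, which pays for the [n]
     letters of the end vertex. *)
  apply: leq_add; first exact: ltnW.
  by apply: leq_trans le_p _; rewrite leq_mul2l excess_le_expn_proper ?orbT.
have [|p [Wp Sp]] := open_walk_cover Wq qS.
  by move=> r sr; apply/negP=> Wr; apply: noback; exists r.
rewrite cardV => le_p; exists s, p, t; split=> //.
have : (2 ^ n).-1 * excess dsrc t S <= (2 ^ n).-1 * 2 ^ n.
  by rewrite leq_mul2l excess_le_expn_proper ?orbT.
(* With [2 ^ n = m.+1] and [n <= m], the length is at most m + m(m + 1) + m, which is below (m +
   1)(m + 2). *)
move: le_p ltn2; case: (2 ^ n) => // m; rewrite !mulSn !mulnS /=.
move: (m * excess _ _ _) (m * m); clear; lia.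
Qed.

End DeBruijn.

Theorem proposition14 (n : nat) (hn : 1 <= n) :
  mu n <= 2 ^ (2 * n - 2) + 2 ^ (n - 1) /\
  nu n <= 2 ^ (2 * n - 2) + 2 ^ (n - 1).
Proof.
case: n hn => // n _.
have -> : 2 ^ (2 * n.+1 - 2) + 2 ^ (n.+1 - 1) = 2 ^ n * (2 ^ n).+1.
  by rewrite [RHS]mulnS -expnD addnC; congr (2 ^ _ + 2 ^ _); lia.
split; apply/bigmax_leqP => S /andP[S0 /asboolP repS].
  have [_ min_le] := shortest_lengthP repS.
  by have [w /min_le le_w] := short_witness S0 repS; apply: leq_trans.
have [_ min_le] := shortest_lengthP repS.
by have [w /min_le le_w] := short_cwitness S0 repS; apply: leq_trans.
Qed.
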